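(* For every binary tree $T$, the polynomial $\mathcal B_T(x)$ equals $\sum_{T'\le T} x^{\lambda(T')}$, where the sum runs over binary trees $T'$ (of the same size as $T$) with $T'\le T$ in the Tamari order and $\lambda(T')$ is the number of nodes on the left branch of $T'$; in particular $\mathcal B_T(1)$ is the number of trees $T'\le T$. Symmetrically, $\tilde{\mathcal B}_T(x)=\sum_{T'\ge T}x^{\rho(T')}$, where $\rho(T')$ is the number of nodes on the right branch of $T'$.
   Context: A binary tree is either empty or a root node with an ordered pair (left subtree, right subtree) of binary trees; its size is its number of nodes. The left (resp. right) branch of a nonempty tree is the sequence of nodes obtained from the root by repeatedly going to the left (resp. right) child. A right rotation replaces a subtree of the form $y(x(A,B),C)$ (node $y$ whose left child is $x$; $A,B,C$ possibly empty) by $x(A,y(B,C))$. The Tamari order on binary trees of size $n$: $T\le T'$ iff $T'$ is obtained from $T$ by a finite sequence of right rotations. Define $\mathcal B_\emptyset=1$ and, for $T$ with left subtree $L$ and right subtree $R$, $$\mathcal B_T(x)=x\,\mathcal B_L(x)\,\frac{x\,\mathcal B_R(x)-\mathcal B_R(1)}{x-1}.$$ Define $\tilde{\mathcal B}_\emptyset=1$ and $\tilde{\mathcal B}_T(x)=x\,\tilde{\mathcal B}_R(x)\,\frac{x\,\tilde{\mathcal B}_L(x)-\tilde{\mathcal B}_L(1)}{x-1}$ (roles of the left and right subtrees exchanged). *)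

(* Defs.v *)
From HB Require Import structures.
From mathcomp Require Import all_boot all_order all_algebra.

Set Implicit Arguments.
Unset Strict Implicit.
Unset Printing Implicit Defensive.

Import GRing.Theory.
Local Open Scope ring_scope.

Inductive bintree : Type := Empty | Node of bintree & bintree.

Fixpoint tree_encode (T : bintree) : GenTree.tree unit :=
  if T is Node L R then GenTree.Node 0 [:: tree_encode L; tree_encode R]
  else GenTree.Leaf tt.

Fixpoint tree_decode (t : GenTree.tree unit) : option bintree :=
  match t with
  | GenTree.Leaf _ => Some Empty
  | GenTree.Node _ [:: l; r] =>
      if (tree_decode l, tree_decode r) is (Some L, Some R)
      then Some (Node L R) else None
  | _ => None
  end.

Lemma tree_encodeK : pcancel tree_encode tree_decode.
Proof. by elim=> //= L -> R ->. Qed.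

HB.instance Definition _ := Countable.copy bintree (pcan_type tree_encodeK).

Fixpoint tree_size (T : bintree) : nat :=
  if T is Node L R then (tree_size L + tree_size R).+1 else 0%N.

Fixpoint left_branch_size (T : bintree) : nat :=
  if T is Node L _ then (left_branch_size L).+1 else 0%N.

Fixpoint right_branch_size (T : bintree) : nat :=
  if T is Node _ R then (right_branch_size R).+1 else 0%N.

(* One-step rotations y(x(A,B),R) -> x(A,y(B,R)), applied at any node of T. *)
Fixpoint right_rotations (T : bintree) : seq bintree :=
  if T is Node L R then
    (if L is Node A B then [:: Node A (Node B R)] else [::])
    ++ [seq Node L' R | L' <- right_rotations L]
    ++ [seq Node L R' | R' <- right_rotations R]
  else [::].

Record sized_tree (n : nat) : Type :=
  SizedTree { tree_val :> bintree; _ : tree_size tree_val == n }.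

HB.instance Definition _ n := [isSub for @tree_val n].
HB.instance Definition _ n := [Countable of sized_tree n by <:].

(* Trees of height, not size, at most h: simpler to generate, and enough to
   enumerate sized_tree n. *)
Fixpoint trees_upto (h : nat) : seq bintree :=
  if h is h'.+1
  then Empty :: [seq Node L R | L <- trees_upto h', R <- trees_upto h']
  else [:: Empty].

Lemma mem_trees_upto h T : (tree_size T <= h)%N -> T \in trees_upto h.
Proof.
elim: h T => [|h IHh] [|L R] //=; rewrite ltnS inE /= => leLRh.
apply/allpairsP; exists (L, R); split=> //; apply: IHh.
  exact: leq_trans (leq_addr _ _) leLRh.
exact: leq_trans (leq_addl _ _) leLRh.
Qed.

Definition sized_tree_enum n : seq (sized_tree n) :=
  undup (pmap insub (trees_upto n)).

Lemma sized_tree_enumP n : Finite.axiom (sized_tree_enum n).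
Proof.
apply: Finite.uniq_enumP => [|T]; first exact: undup_uniq.
rewrite mem_undup mem_pmap_sub /= mem_trees_upto //.
by rewrite (eqP (valP T)).
Qed.

HB.instance Definition _ n := isFinite.Build (sized_tree n) (@sized_tree_enumP n).

Definition tamari_le n (T T' : sized_tree n) : bool :=
  connect [rel S S' : sized_tree n | val S' \in right_rotations (val S)] T T'.

(* (x P(x) - P(1)) / (x - 1); the division is exact by divided_shiftE. *)
Definition divided_shift (P : {poly int}) : {poly int} :=
  ('X * P - (P.[1])%:P) %/ ('X - 1).

Lemma divided_shiftE P : divided_shift P * ('X - 1) = 'X * P - (P.[1])%:P.
Proof.
have root1 : root ('X * P - (P.[1])%:P) 1.
  by rewrite /root !hornerE subrr.
have [Q defQ] := factor_theorem _ _ root1.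
by rewrite /divided_shift defQ polyC1 Pdiv.IdomainMonic.mulpK // monicXsubC.
Qed.

Fixpoint tamari_poly (T : bintree) : {poly int} :=
  if T is Node L R then
    'X * tamari_poly L * divided_shift (tamari_poly R)
  else 1.

Fixpoint tamari_poly_dual (T : bintree) : {poly int} :=
  if T is Node L R then
    'X * tamari_poly_dual R * divided_shift (tamari_poly_dual L)
  else 1.

(* Main.v *)
(* Left rotations at the root of T = Node L R push the root of T down the left
   branch of R.  The trees below T are therefore obtained exactly once each, by
   choosing L' <= L and R' <= R and then inserting the root of T, carrying L' as
   left subtree, at one of the positions 0, ..., lambda(R') of the left branch
   of R'.  Position i gives a left branch of size i + 1 + lambda(L'), and summing
   the geometric progression over i yields the recursion defining B_T.  The dual
   statement follows by mirroring trees, which reverses rotations. *)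
Require Import Defs.
From Stdlib Require Import Relation_Operators.
From mathcomp Require Import all_boot all_order all_algebra zify ring.

Set Implicit Arguments.
Unset Strict Implicit.
Unset Printing Implicit Defensive.

Import GRing.Theory.
Local Open Scope ring_scope.

(** * Rotations and the Tamari order on bare trees *)

Inductive rotation : bintree -> bintree -> Prop :=
| RotRoot A B C : rotation (Node (Node A B) C) (Node A (Node B C))
| RotLeft L L' R : rotation L L' -> rotation (Node L R) (Node L' R)
| RotRight L R R' : rotation R R' -> rotation (Node L R) (Node L R').

Lemma rotationP S S' : reflect (rotation S S') (S' \in right_rotations S).
Proof.
apply: (iffP idP) => [|rotSS'].
  elim: S S' => [//|L IHL R IHR] S' /=.
  rewrite !mem_cat => /or3P[|/mapP[L' + ->]|/mapP[R' + ->]].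
  - by case: L {IHL} => [//|A B]; rewrite inE => /eqP->; apply: RotRoot.
  - by move/IHL; apply: RotLeft.
  - by move/IHR; apply: RotRight.
elim: rotSS' => {S S'} [A B C|L L' R _ memL'|L R R' _ memR'].
- by rewrite mem_head.
- by rewrite /= !mem_cat (map_f (Node^~ R)) ?orbT.
- by rewrite /= !mem_cat (map_f (Node L)) ?orbT.
Qed.

Lemma rotation_size S S' : rotation S S' -> tree_size S' = tree_size S.
Proof. by elim=> /=; lia. Qed.

(** Carries no size index, so that inductions can pass freely to subtrees. *)
Definition tree_le : bintree -> bintree -> Prop := clos_refl_trans bintree rotation.

Lemma tree_le_size S S' : tree_le S S' -> tree_size S' = tree_size S.
Proof. by elim=> [? ? /rotation_size| |? ? ? _ + _ ->]. Qed.

Lemma tree_le_map (f : bintree -> bintree) S S' :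
  (forall U U', rotation U U' -> rotation (f U) (f U')) ->
  tree_le S S' -> tree_le (f S) (f S').
Proof.
move=> mono_f; elim=> {S S'} [U U' /mono_f| |U V W _ leUV _]; first exact: rt_step.
  by move=> U; apply: rt_refl.
exact: rt_trans.
Qed.

Lemma tree_le_node L L' R R' :
  tree_le L L' -> tree_le R R' -> tree_le (Node L R) (Node L' R').
Proof.
move=> leL leR; apply: (@rt_trans _ _ _ (Node L' R)).
  by apply: (tree_le_map (f := Node^~ R)) leL => U U'; apply: RotLeft.
by apply: tree_le_map leR => U U'; apply: RotRight.
Qed.

Lemma tamari_leP n (S T : sized_tree n) : reflect (tree_le S T) (tamari_le S T).
Proof.
apply: (iffP idP) => [/connectP[p]|].
  elim: p S => [|U p IHp] S /=; first by move=> _ ->; apply: rt_refl.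
  case/andP=> /rotationP rotSU pathUp /(IHp _ pathUp).
  by apply: rt_trans; apply: rt_step.
case: S T => [S sizeS] [T sizeT] /= leST.
elim: leST sizeS sizeT => {S T} [S T rotST|S|S U T leSU IHSU _ IHUT] sizeS sizeT.
- by apply: connect1; apply/rotationP.
- by rewrite (bool_irrelevance sizeT sizeS); apply: connect0.
(* Rotations preserve size, so the intermediate tree is again a [sized_tree n]. *)
have sizeU : tree_size U == n by rewrite (tree_le_size leSU).
exact: connect_trans (IHSU sizeS sizeU) (IHUT sizeU sizeT).
Qed.

(** * Insertion along a left branch *)

(* Junk for i > left_branch_size R: the same tree as for i = left_branch_size R. *)
Fixpoint insert_left (L R : bintree) (i : nat) {struct i} : bintree :=
  if i is i'.+1 then
    if R is Node A B then Node (insert_left L A i') B else Node L R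
  else Node L R.

Lemma insert_left_branch L R i : (i <= left_branch_size R)%N ->
  left_branch_size (insert_left L R i) = (left_branch_size L + i).+1.
Proof. by elim: i R => [|i IHi] [|A B] //= leiR; rewrite ?addn0 // IHi ?addnS. Qed.

Lemma insert_left_size L R i :
  tree_size (insert_left L R i) = (tree_size L + tree_size R).+1.
Proof. by elim: i R => [|i IHi] [|A B] //=; rewrite IHi; lia. Qed.

(** By induction the inserted node rises to the root of the left subtree [A]; one more rotation at
    the root makes it the root of the whole tree. *)
Lemma insert_left_le L R i : tree_le (insert_left L R i) (Node L R).
Proof.
elim: i R => [|i IHi] [|A B] /=; do ?exact: rt_refl.
apply: (@rt_trans _ _ _ (Node (Node L A) B)).
  by apply: tree_le_node => //; apply: rt_refl.
by apply: rt_step; apply: RotRoot.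
Qed.

(* The inserted node is the only one of the left branch whose left subtree has
   the size of L. *)
Lemma insert_left_inj L1 L2 R1 R2 i1 i2 :
  (i1 <= left_branch_size R1)%N -> (i2 <= left_branch_size R2)%N ->
  tree_size L1 = tree_size L2 ->
  insert_left L1 R1 i1 = insert_left L2 R2 i2 ->
  [/\ L1 = L2, R1 = R2 & i1 = i2].
Proof.
elim: i1 i2 R1 R2 => [|i1 IHi] [|i2] R1 R2 //=.
- by move=> _ _ _ [-> ->].
- case: R2 => [//|A B] _ _ eqL [defL _].
  by have := congr1 tree_size defL; rewrite insert_left_size; lia.
- case: R1 => [//|A B] _ _ eqL [defL _].
  by have := congr1 tree_size defL; rewrite insert_left_size; lia.
case: R1 R2 => [|A1 B1] // [|A2 B2] //= le1 le2 eqL [eqA ->].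
by have [-> -> ->] := IHi i2 A1 A2 le1 le2 eqL eqA.
Qed.

(** Undoing a rotation either acts inside [L] or [R], or moves the inserted node one position down,
    or lengthens the left branch of [R] above it. This is what makes the set of insertions closed
    downwards. *)
Lemma rotation_insert_left W L R i :
  (i <= left_branch_size R)%N -> rotation W (insert_left L R i) ->
  exists L' R' i', [/\ W = insert_left L' R' i', (i' <= left_branch_size R')%N,
                       tree_le L' L & tree_le R' R].
Proof.
elim: i W R => [|i IHi] W R /=.
  move=> _ rotW; inversion rotW as [A B C|U L' R0 rotU|U R' R0 rotR]; subst.
  (* Here [W] is [Node (Node L B) C]: the inserted node has gone down one position. *)
  - by exists L, (Node B C), 1%N; split=> //; apply: rt_refl.
  - by exists U, R, 0%N; split=> //; [apply: rt_step | apply: rt_refl].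
  - by exists L, R', 0%N; split=> //; [apply: rt_refl | apply: rt_step].
case: R => [//|A B] leiA rotW.
inversion rotW as [A0 D E|U U' R0 rotU|U B' R0 rotB]; subst.
(* The undone rotation puts a new node above the insertion point, which shifts its position by
   one. *)
- exists L, (Node (Node A D) E), i.+2; split=> //; first exact: rt_refl.
  by apply: rt_step; apply: RotRoot.
- have [L' [A' [i' [-> lei' leL leA]]]] := IHi _ _ leiA rotU.
  exists L', (Node A' B), i'.+1; split=> //.
  by apply: tree_le_node => //; apply: rt_refl.
- exists L, (Node A B'), i.+1; split=> //; first exact: rt_refl.
  by apply: rt_step; apply: RotRight.
Qed.

(** * The lower set of a tree as a duplicate-free list *)

Fixpoint lower_trees (T : bintree) : seq bintree :=
  if T is Node L R then
    [seq insert_left P.1 P.2 i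
       | P <- [seq (L', R') | L' <- lower_trees L, R' <- lower_trees R],
         i <- iota 0 (left_branch_size P.2).+1]
  else [:: Empty].

Lemma lower_trees_nodeP L R T :
  reflect (exists L' R' i, [/\ L' \in lower_trees L, R' \in lower_trees R,
              (i <= left_branch_size R')%N & T = insert_left L' R' i])
          (T \in lower_trees (Node L R)).
Proof.
apply: (iffP allpairsPdep) => [[_ [i [/allpairsP[[L' R'] [memL memR ->]] + ->]]]|].
  by rewrite mem_iota ltnS => lei; exists L', R', i.
case=> L' [R' [i [memL memR lei ->]]]; exists (L', R'), i; split=> //.
  by apply/allpairsP; exists (L', R').
by rewrite mem_iota ltnS.
Qed.

Lemma lower_treesP S T : reflect (tree_le S T) (S \in lower_trees T).
Proof.
apply: (iffP idP) => [|leST].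
  elim: T S => [|L IHL R IHR] S; first by rewrite inE => /eqP->; apply: rt_refl.
  case/lower_trees_nodeP=> L' [R' [i [/IHL leL /IHR leR _ ->]]].
  by apply: rt_trans (tree_le_node leL leR); apply: insert_left_le.
have memT: T \in lower_trees T.
  elim: T {leST} => [|L IHL R IHR]; first exact: mem_head.
  by apply/lower_trees_nodeP; exists L, R, 0%N.
(* Closure is stated for chains, not single rotations, because [rotation_insert_left] returns
   subtrees related by [tree_le], to which the induction hypotheses must apply. *)
suff down U V W : tree_le U V -> V \in lower_trees W -> U \in lower_trees W.
  exact: down leST memT.
elim: W U V => [|L IHL R IHR] U V.
  by move=> /tree_le_size sizeU; rewrite !inE => /eqP defV; move: sizeU;
    rewrite defV; case: U.
elim=> {U V} [U V rotUV|//|U V W _ IHUV _ IHVW /IHVW //].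
case/lower_trees_nodeP=> L1 [R1 [i [memL memR lei defV]]].
have [||L' [R' [i' [-> lei' leL leR]]]] := @rotation_insert_left U L1 R1 i => //.
  by rewrite -defV.
apply/lower_trees_nodeP; exists L', R', i'.
by split=> //; [apply: IHL leL memL | apply: IHR leR memR].
Qed.

Lemma lower_trees_uniq T : uniq (lower_trees T).
Proof.
elim: T => [//|L uniqL R uniqR].
apply: allpairs_uniq_dep => [|P _|].
- by apply: allpairs_uniq => // -[? ?] [? ?].
- exact: iota_uniq.
move=> _ _ /allpairsPdep[P1 [i1 [mem1 + ->]]] /allpairsPdep[P2 [i2 [mem2 + ->]]] /=.
rewrite !mem_iota !ltnS /= => le1 le2.
case/allpairsP: mem1 le1 => -[L1 R1] /= [/lower_treesP/tree_le_size sz1 _ ->].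
case/allpairsP: mem2 le2 => -[L2 R2] /= [/lower_treesP/tree_le_size sz2 _ ->].
(* Both [L1] and [L2] lie below [L], hence have its size, as [insert_left_inj] requires. *)
move=> le2 le1 eq12; have [|-> -> -> //] := insert_left_inj le1 le2 _ eq12.
by rewrite -sz1.
Qed.

(** * The recursion as a sum over the list *)

(** The operator is additive and sends ['X^k] to the geometric sum with quotient
    [('X^k.+1 - 1) / ('X - 1)]; both sides are compared after multiplication by ['X - 1]. *)
Lemma divided_shift_sum (I : Type) (s : seq I) (f : I -> nat) :
  divided_shift (\sum_(t <- s) 'X^(f t)) =
  \sum_(t <- s) \sum_(i < (f t).+1) 'X^i.
Proof.
have nzX1 : 'X - 1 != 0 :> {poly int} by rewrite -polyC1 polyXsubC_eq0.
apply: (mulIf nzX1); rewrite divided_shiftE.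
elim: s => [|t s IHs]; first by rewrite !big_nil !mulr0 horner0 subr0 mul0r.
rewrite !big_cons mulrDl -IHs hornerD hornerXn expr1n polyCD.
have ->: (\sum_(i < (f t).+1) 'X^i) * ('X - 1) = 'X * 'X^(f t) - 1 :> {poly int}.
  by rewrite mulrC -subrX1 exprS.
by rewrite polyC1; ring.
Qed.

Lemma tamari_poly_lower_trees T :
  tamari_poly T = \sum_(S <- lower_trees T) 'X^(left_branch_size S).
Proof.
elim: T => [|L IHL R IHR]; first by rewrite big_seq1 expr0.
rewrite [LHS]/= IHL IHR divided_shift_sum /lower_trees -/lower_trees.
rewrite big_allpairs_dep big_allpairs.
rewrite -mulrA mulr_suml mulr_sumr.
apply: eq_bigr => L' _; rewrite mulr_sumr mulr_sumr; apply: eq_bigr => R' _.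
rewrite mulr_sumr -(big_mkord xpredT (fun i => _ * 'X^i)) /index_iota subn0.
(* Restricting to members of [iota] recovers the bound on [i] under which [insert_left_branch] gives
   the exponent. *)
rewrite mulr_sumr !big_seq; apply: eq_bigr => i; rewrite mem_iota ltnS /= => lei.
by rewrite insert_left_branch // exprS exprD.
Qed.

Lemma big_sized_tree n (s : seq bintree) (F : bintree -> {poly int}) :
  uniq s -> {in s, forall S, tree_size S = n} ->
  \sum_(S <- s) F S = \sum_(S : sized_tree n | tree_val S \in s) F S.
Proof.
move=> uniq_s size_s.
rewrite -[RHS]big_filter -(big_map val xpredT F).
apply: perm_big; apply: uniq_perm => //.
  by rewrite (map_inj_uniq val_inj) filter_uniq ?index_enum_uniq.
move=> S; apply/idP/mapP => [memS|[S']]; last by rewrite mem_filter => /andP[? _] ->.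
have sizeS : tree_size S == n by rewrite size_s.
by exists (SizedTree sizeS); rewrite // mem_filter memS mem_index_enum.
Qed.

(** * Mirror symmetry and the dual statement *)

Fixpoint mirror (T : bintree) : bintree :=
  if T is Node L R then Node (mirror R) (mirror L) else Empty.

Lemma mirrorK : involutive mirror.
Proof. by elim=> //= L -> R ->. Qed.

Lemma mirror_size T : tree_size (mirror T) = tree_size T.
Proof. by elim: T => //= L -> R ->; rewrite addnC. Qed.

Lemma left_branch_mirror T : left_branch_size (mirror T) = right_branch_size T.
Proof. by elim: T => //= L _ R ->. Qed.

Lemma rotation_mirror S T : rotation S T -> rotation (mirror T) (mirror S).
Proof. by elim=> *; constructor. Qed.

Lemma tree_le_mirror S T : tree_le S T -> tree_le (mirror T) (mirror S).
Proof.
elim=> {S T} [S T /rotation_mirror|S|S U T _ leUS _ leTU]; first exact: rt_step.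
  exact: rt_refl.
exact: rt_trans leTU leUS.
Qed.

Lemma tamari_poly_dual_mirror T : tamari_poly_dual T = tamari_poly (mirror T).
Proof. by elim: T => //= L -> R ->. Qed.

Lemma tamari_poly_sum n (T : sized_tree n) :
  tamari_poly T =
    \sum_(T' : sized_tree n | tamari_le T' T) 'X^(left_branch_size T').
Proof.
rewrite tamari_poly_lower_trees (@big_sized_tree n) ?lower_trees_uniq //; last first.
  by move=> S /lower_treesP/tree_le_size <-; apply/eqP/(valP T).
by apply: eq_bigl => S; apply/lower_treesP/tamari_leP.
Qed.

Lemma tamari_poly_dual_sum n (T : sized_tree n) :
  tamari_poly_dual T =
    \sum_(T' : sized_tree n | tamari_le T T') 'X^(right_branch_size T').
Proof.
have sizeM (S : sized_tree n) : tree_size (mirror S) == n.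
  by rewrite mirror_size; apply: (valP S).
pose mir S : sized_tree n := SizedTree (sizeM S).
have mirK : involutive mir by move=> S; apply: val_inj; apply: mirrorK.
rewrite tamari_poly_dual_mirror (tamari_poly_sum (mir T)).
(* Mirroring is an order-reversing involution, so it carries the sum below [mir T] to the sum above
   [T]. *)
rewrite (reindex_inj (inv_inj mirK)); apply: eq_big => [S|S _] /=.
  apply/tamari_leP/tamari_leP => /= /tree_le_mirror; last by [].
  by rewrite !mirrorK.
by rewrite left_branch_mirror.
Qed.

Theorem theorem7p0p6 (n : nat) (T : sized_tree n) :
  [/\ tamari_poly T =
        \sum_(T' : sized_tree n | tamari_le T' T) 'X^(left_branch_size T'),
      (tamari_poly T).[1] = #|[set T' : sized_tree n | tamari_le T' T]|%:R
    & tamari_poly_dual T =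
        \sum_(T' : sized_tree n | tamari_le T T') 'X^(right_branch_size T')].
Proof.
split; [exact: tamari_poly_sum | | exact: tamari_poly_dual_sum].
rewrite tamari_poly_sum horner_sum cardsE -sumr_const.
by apply: eq_bigr => S _; rewrite hornerXn expr1n.
Qed.
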